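(* Let $\mathfrak{M}$ be a listable $\mathscr{L}$-structure with domain $M$. Let $r,k$ be positive integers and $c\in\mathbb{N}$. Let $h=(h_1,\dots,h_r):\mathbb{N}\to\mathbb{N}^r$ be a total recursive function with $h_j(n)<n$ for each $j$ and all $n>c$; let $A_1,\dots,A_k$ be a partition of $\mathbb{N}_{>c}$ into decidable sets; and for each $i=1,\dots,k$ let $F_i:V_i\to M$ be a p.e. $\mathscr{L}$-definable function with domain $V_i\subseteq M^r$. Let $\tau:\mathbb{N}\to M$ be a function such that (i) $\tau$ is surjective; (ii) if $n\in A_i$ and $n>c$ then $h(n)\in\tau^*(V_i)$; (iii) for each $n>c$, $\tau(n)=F_i(\tau(h_1(n)),\dots,\tau(h_r(n)))$ where $i$ is the index with $n\in A_i$. Then $\tau$ is a universal listing. In particular, $\mathfrak{M}$ is uniquely listable and $\tau$ is a listable presentation of $\mathfrak{M}$.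
   Context: All languages contain $=$, interpreted as equality. Listable means recursively enumerable. For $\rho:A\to B$ and $S\subseteq B^r$, $\rho^*(S)$ is the preimage of $S$ under the coordinatewise map $A^r\to B^r$. A listable presentation of $\mathfrak{M}$ is a surjection $\rho:\mathbb{N}\to M$ with $\rho^*(s^{\mathfrak{M}})$ listable for every symbol $s\in\mathscr{L}$ (function symbols via graphs); $\mathfrak{M}$ is listable if one exists. Presentations $\rho,\gamma$ are equivalent if $\gamma=\rho\circ\phi$ for a total recursive $\phi:\mathbb{N}\to\mathbb{N}$; uniquely listable means all listable presentations are equivalent. A universal listing for $\mathfrak{M}$ is a surjection $\tau:\mathbb{N}\to M$ such that for every listable presentation $\rho$ there is a total recursive $a:\mathbb{N}\to\mathbb{N}$ with $\rho\circ a=\tau$. A p.e. formula uses only atomic formulas, $\wedge,\vee,\exists$; a function is p.e. $\mathscr{L}$-definable if its graph is p.e. $\mathscr{L}$-definable without parameters. *)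

(* Defs.v *)
From mathcomp Require Import all_boot.
From mathcomp Require Import boolp classical_sets functions.

Set Implicit Arguments.
Unset Strict Implicit.
Unset Printing Implicit Defensive.

Local Open Scope classical_set_scope.

(* Total recursive functions nat^k -> nat: the least class containing the
   initial functions and closed under composition, primitive recursion and
   minimization of regular functions (those having a zero for every value of
   the parameters), so that every member is total. *)
Inductive recursive : forall k, (k.-tuple nat -> nat) -> Prop :=
| rec_zero k : @recursive k (fun=> 0)
| rec_succ : @recursive 1 (fun x => (thead x).+1)
| rec_proj k (i : 'I_k) : recursive (fun x => tnth x i)
| rec_comp k m (f : m.-tuple nat -> nat) (g : 'I_m -> k.-tuple nat -> nat) :
    recursive f -> (forall j, recursive (g j)) ->
    recursive (fun x => f [tuple g j x | j < m])
| rec_prim k (f : k.-tuple nat -> nat) (g : k.+2.-tuple nat -> nat)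
    (h : k.+1.-tuple nat -> nat) :
    recursive f -> recursive g ->
    (forall x : k.-tuple nat, h [tuple of 0 :: x] = f x) ->
    (forall n (x : k.-tuple nat), h [tuple of n.+1 :: x] =
       g [tuple of n :: h [tuple of n :: x] :: x]) ->
    recursive h
| rec_min k (f : k.+1.-tuple nat -> nat) (h : k.-tuple nat -> nat) :
    recursive f ->
    (forall x : k.-tuple nat, f [tuple of h x :: x] = 0) ->
    (forall (x : k.-tuple nat) y, y < h x -> f [tuple of y :: x] <> 0) ->
    recursive h.

Definition recursive1 (f : nat -> nat) : Prop :=
  recursive (fun x : 1.-tuple nat => f (thead x)).

Definition recursive_map r (h : nat -> r.-tuple nat) : Prop :=
  forall j : 'I_r, recursive1 (fun n => tnth (h n) j).

Definition decidable_set (A : set nat) : Prop :=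
  exists chi : pred nat, recursive1 (fun n => chi n : nat) /\
    forall n, A n <-> chi n.

Definition listable_set r (S : set (r.-tuple nat)) : Prop :=
  S = set0 \/ exists2 f : nat -> r.-tuple nat, recursive_map f & S = range f.

(* Equality belongs to every language and is always interpreted as equality,
   hence it is not a member of [rel_symb]. Constants are functions of arity 0. *)
Record language := Language {
  func_symb : Type;
  func_arity : func_symb -> nat;
  rel_symb : Type;
  rel_arity : rel_symb -> nat
}.

Record structure (L : language) (M : Type) := Structure {
  func_interp : forall f : func_symb L, (func_arity f).-tuple M -> M;
  rel_interp : forall R : rel_symb L, set ((rel_arity R).-tuple M)
}.

(* Terms and formulas with free variables among x_0, ..., x_{n-1};
   [PeEx] binds x_0 and shifts the other variables. *)
Inductive term (L : language) (n : nat) : Type :=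
| Var of 'I_n
| App (f : func_symb L) of ('I_(func_arity f) -> term L n).

Inductive pe_formula (L : language) : nat -> Type :=
| PeEq n of term L n & term L n : pe_formula L n
| PeRel n (R : rel_symb L) of ('I_(rel_arity R) -> term L n) : pe_formula L n
| PeAnd n of pe_formula L n & pe_formula L n : pe_formula L n
| PeOr n of pe_formula L n & pe_formula L n : pe_formula L n
| PeEx n of pe_formula L n.+1 : pe_formula L n.

Section Semantics.
Variables (L : language) (M : Type) (S : structure L M).

Fixpoint eval n (x : n.-tuple M) (t : term L n) : M :=
  match t with
  | Var i => tnth x i
  | App f u => func_interp S [tuple eval x (u i) | i < func_arity f]
  end.

Fixpoint sat n (phi : pe_formula L n) : n.-tuple M -> Prop :=
  match phi in pe_formula _ n return n.-tuple M -> Prop with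
  | PeEq _ t u => fun x => eval x t = eval x u
  | PeRel _ R u => fun x =>
      rel_interp S [tuple eval x (u i) | i < rel_arity R]
  | PeAnd _ p q => fun x => sat p x /\ sat q x
  | PeOr _ p q => fun x => sat p x \/ sat q x
  | PeEx _ p => fun x => exists a : M, sat p [tuple of a :: x]
  end.

Definition pe_definable_set n (D : set (n.-tuple M)) : Prop :=
  exists phi : pe_formula L n, D = [set x | sat phi x].

End Semantics.

Definition graph r M (V : set (r.-tuple M)) (F : V -> M) :
    set (r.+1.-tuple M) :=
  [set z | exists x : V, z = [tuple of rcons (val x) (F x)]].

Definition total_graph r M (f : r.-tuple M -> M) : set (r.+1.-tuple M) :=
  [set z | exists x : r.-tuple M, z = [tuple of rcons x (f x)]].

Definition pe_definable_function L M (S : structure L M) r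
    (V : set (r.-tuple M)) (F : V -> M) : Prop :=
  pe_definable_set S (graph F).

Definition pullback A B (rho : A -> B) r (S : set (r.-tuple B)) :
    set (r.-tuple A) :=
  [set x | S (map_tuple rho x)].

Definition diagonal M : set (2.-tuple M) :=
  [set x | tnth x ord0 = tnth x ord_max].

Section Presentations.
Variables (L : language) (M : Type) (S : structure L M).

Definition listable_presentation (rho : nat -> M) : Prop :=
  [/\ set_surj [set: nat] [set: M] rho,
      listable_set (pullback rho (@diagonal M)),
      forall f : func_symb L,
        listable_set (pullback rho (total_graph (@func_interp L M S f))) &
      forall R : rel_symb L, listable_set (pullback rho (@rel_interp L M S R))].

Definition listable : Prop :=
  exists rho : nat -> M, listable_presentation rho.

Definition equivalent_presentations (rho gamma : nat -> M) : Prop :=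
  exists2 phi : nat -> nat, recursive1 phi & gamma = rho \o phi.

Definition uniquely_listable : Prop :=
  forall rho gamma : nat -> M,
    listable_presentation rho -> listable_presentation gamma ->
    equivalent_presentations rho gamma.

Definition universal_listing (tau : nat -> M) : Prop :=
  set_surj [set: nat] [set: M] tau /\
  forall rho : nat -> M, listable_presentation rho ->
    exists2 a : nat -> nat, recursive1 a & rho \o a = tau.

End Presentations.

(* Main.v *)
(** Let [rho] be a listable presentation. Positive existential sets pull back
    along [rho] to recursively enumerable sets, so the pairs [(y, n)] for which
    some finite sequence [T] satisfies [T_n = y] and, for all [i <= n],
    - [T_i] is a fixed [rho]-name of [tau i] when [i <= c],
    - [(T_(h_1 i), ..., T_(h_r i), T_i)] lies in the pullback of the graph of
      some [F_j] with [i \in A_j] otherwise,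
    form a recursively enumerable set. Quantifying over the whole sequence makes
    the search for [y] total, which the search for [T_i] from an arbitrary
    initial segment is not. Induction along [T] gives [rho y = tau n], so
    searching for [y] yields [a] with [rho \o a = tau]. *)

Require Import Defs.
From mathcomp Require Import all_boot.
From mathcomp Require Import boolp classical_sets functions.

Set Implicit Arguments.
Unset Strict Implicit.
Unset Printing Implicit Defensive.

Local Open Scope classical_set_scope.

(** * Closure properties of recursive functions *)

Lemma eq_recursive k (f g : k.-tuple nat -> nat) :
  f =1 g -> recursive f -> recursive g.
Proof. by move=> /funext ->. Qed.

(* [behead_tuple] has type [k.+1.-1.-tuple], which obstructs unification. *)
Definition ttail T k (x : k.+1.-tuple T) : k.-tuple T := behead_tuple x.

Lemma ttail_cons T k (a : T) (x : k.-tuple T) :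
  ttail [tuple of a :: x] = x.
Proof. exact: val_inj. Qed.

Definition recursive_tuple k m (g : k.-tuple nat -> m.-tuple nat) : Prop :=
  forall j, recursive (fun x => tnth (g x) j).

Lemma recursive_comp k m (f : m.-tuple nat -> nat)
    (g : k.-tuple nat -> m.-tuple nat) :
  recursive f -> recursive_tuple g -> recursive (fun x => f (g x)).
Proof.
move=> rf rg; apply: eq_recursive (rec_comp rf rg) => x.
by congr (f _); apply: eq_from_tnth => j; rewrite tnth_mktuple.
Qed.

Lemma recursive_tuple_comp k m p (f : m.-tuple nat -> p.-tuple nat)
    (g : k.-tuple nat -> m.-tuple nat) :
  recursive_tuple f -> recursive_tuple g -> recursive_tuple (fun x => f (g x)).
Proof. by move=> rf rg j; apply: recursive_comp (rf j) rg. Qed.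

Lemma recursive_tuple_id k : recursive_tuple (@id (k.-tuple nat)).
Proof. exact: rec_proj. Qed.

Lemma recursive_tuple_mktuple k m (g : 'I_m -> k.-tuple nat -> nat) :
  (forall j, recursive (g j)) -> recursive_tuple (fun x => [tuple g j x | j < m]).
Proof.
by move=> rg j; apply: eq_recursive (rg j) => x; rewrite tnth_mktuple.
Qed.

Lemma recursive_tuple_cons k m (f : k.-tuple nat -> nat)
    (g : k.-tuple nat -> m.-tuple nat) :
  recursive f -> recursive_tuple g ->
  recursive_tuple (fun x => [tuple of f x :: g x]).
Proof.
move=> rf rg j; case: (unliftP ord0 j) => [i|] ->.
  by apply: eq_recursive (rg i) => x; rewrite tnthS.
by apply: eq_recursive rf.
Qed.

Lemma recursive_tuple_rcons k m (f : k.-tuple nat -> nat)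
    (g : k.-tuple nat -> m.-tuple nat) :
  recursive f -> recursive_tuple g ->
  recursive_tuple (fun x => [tuple of rcons (g x) (f x)]).
Proof.
move=> rf rg j.
have [lt_jm|le_mj] := ltnP j m.
  apply: eq_recursive (rg (Ordinal lt_jm)) => x.
  by rewrite !(tnth_nth 0) /= nth_rcons size_tuple lt_jm.
apply: eq_recursive rf => x.
rewrite (tnth_nth 0) /= nth_rcons size_tuple ltnNge le_mj /=.
by rewrite eqn_leq le_mj -ltnS ltn_ord.
Qed.

Lemma recursive_tuple_ttail k : recursive_tuple (@ttail nat k).
Proof.
move=> j; apply: eq_recursive (rec_proj (lift ord0 j)) => x.
by rewrite tnth_behead; congr tnth; apply: val_inj; rewrite /= inordK ?ltnS.
Qed.

Lemma recursive_thead k : recursive (@thead k nat).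
Proof. exact: rec_proj. Qed.

Lemma recursive_ttail k (f : k.-tuple nat -> nat) :
  recursive f -> recursive (fun x : k.+1.-tuple nat => f (ttail x)).
Proof. by move=> rf; apply: recursive_comp (@recursive_tuple_ttail k). Qed.

Lemma recursive_ttail2 k (f : k.-tuple nat -> nat) :
  recursive f ->
  recursive (fun x : k.+2.-tuple nat => f (ttail (ttail x))).
Proof. by move=> rf; exact (recursive_ttail (recursive_ttail rf)). Qed.

Lemma recursive_comp1 k (f : nat -> nat) (g : k.-tuple nat -> nat) :
  recursive1 f -> recursive g -> recursive (fun x => f (g x)).
Proof.
move=> rf rg; pose y x := [tuple of g x :: [tuple]].
apply: (@eq_recursive _ (fun x => f (thead (y x)))) => //.
apply: (recursive_comp rf); apply: recursive_tuple_cons => // -[].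
by [].
Qed.

Lemma recursive_succ k (f : k.-tuple nat -> nat) :
  recursive f -> recursive (fun x => (f x).+1).
Proof. exact: recursive_comp1 rec_succ. Qed.

Lemma recursive_const k n : recursive (fun _ : k.-tuple nat => n).
Proof. by elim: n => [|n /recursive_succ]; first exact: rec_zero. Qed.

(** [rec_prim] recurses on the head coordinate and keeps the tail as parameters. Here the number of
    iterations and the parameters come from the same [x]: [H] is built by [rec_prim], and [t x :: x]
    is substituted into it. *)
Lemma recursive_nat_rect k (t b : k.-tuple nat -> nat)
    (s : nat -> nat -> k.-tuple nat -> nat) :
  recursive t -> recursive b ->
  recursive (fun x : k.+2.-tuple nat =>
    s (thead x) (thead (ttail x)) (ttail (ttail x))) ->
  recursive (fun x => nat_rect (fun=> nat) (b x) (fun n y => s n y x) (t x)).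
Proof.
move=> rt rb rs.
pose H (x : k.+1.-tuple nat) := let x' := ttail x in
  nat_rect (fun=> nat) (b x') (fun n y => s n y x') (thead x).
have rH : recursive H.
  apply: (rec_prim rb rs) => [x|n x]; rewrite /H !ttail_cons //=.
apply: (@eq_recursive _ (fun x => H [tuple of t x :: x])) => [x|].
  by rewrite /H ttail_cons.
apply: (recursive_comp rH).
exact: recursive_tuple_cons rt (@recursive_tuple_id k).
Qed.

Lemma recursive_add k (f g : k.-tuple nat -> nat) :
  recursive f -> recursive g -> recursive (fun x => f x + g x).
Proof.
move=> rf rg.
have := recursive_nat_rect (s := fun _ y _ => y.+1) rf rg.
have r : recursive (fun x : k.+2.-tuple nat => (thead (ttail x)).+1).
  by apply/recursive_succ/recursive_ttail/recursive_thead.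
move=> /(_ r); apply: eq_recursive => x.
by elim: (f x) => //= n ->.
Qed.

Lemma recursive_mul k (f g : k.-tuple nat -> nat) :
  recursive f -> recursive g -> recursive (fun x => f x * g x).
Proof.
move=> rf rg.
have := recursive_nat_rect (s := fun _ y x => g x + y) rf (recursive_const k 0).
have r : recursive (fun x : k.+2.-tuple nat =>
    g (ttail (ttail x)) + thead (ttail x)).
  apply: recursive_add; last exact/recursive_ttail/recursive_thead.
  exact: recursive_ttail2.
move=> /(_ r); apply: eq_recursive => x.
by elim: (f x) => //= n ->.
Qed.

Lemma recursive_sub k (f g : k.-tuple nat -> nat) :
  recursive f -> recursive g -> recursive (fun x => f x - g x).
Proof.
move=> rf rg.
have rpred m (u : m.-tuple nat -> nat) :
    recursive u -> recursive (fun x => (u x).-1).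
  move=> ru.
  (* The predecessor is the recursion whose step returns its index and forgets the previous
     value. *)
  have := recursive_nat_rect (s := fun n _ _ => n) ru (recursive_const m 0).
  move=> /(_ (recursive_thead _)).
  by apply: eq_recursive => x; case: (u x).
have := recursive_nat_rect (s := fun _ y _ => y.-1) rg rf.
have r : recursive (fun x : k.+2.-tuple nat => (thead (ttail x)).-1).
  by apply/rpred/recursive_ttail/recursive_thead.
move=> /(_ r); apply: eq_recursive => x.
by elim: (g x) => [|n /= ->]; rewrite ?subn0 // subnS.
Qed.

Lemma recursive_if k (f g h : k.-tuple nat -> nat) :
  recursive f -> recursive g -> recursive h ->
  recursive (fun x => if f x == 0 then g x else h x).
Proof.
(* A step that always returns [h x] makes the result depend only on whether at least one iteration
   takes place. *)
move=> rf rg rh; have := recursive_nat_rect (s := fun _ _ x => h x) rf rg.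
have r : recursive (fun x : k.+2.-tuple nat => h (ttail (ttail x))).
  exact: recursive_ttail2.
by move=> /(_ r); apply: eq_recursive => x; case: (f x).
Qed.

Lemma recursive_sum k (t : k.-tuple nat -> nat)
    (f : nat -> k.-tuple nat -> nat) :
  recursive t ->
  recursive (fun x : k.+1.-tuple nat => f (thead x) (ttail x)) ->
  recursive (fun x => \sum_(i < t x) f i x).
Proof.
move=> rt rf.
have := recursive_nat_rect (s := fun i y x => y + f i x) rt (recursive_const k 0).
have r : recursive (fun x : k.+2.-tuple nat => thead (ttail x) +
    f (thead x) (ttail (ttail x))).
  apply: recursive_add; first exact/recursive_ttail/recursive_thead.
  pose y (x : k.+2.-tuple nat) :=
    [tuple of thead x :: ttail (ttail x)].
  apply: (@eq_recursive _ (fun x => f (thead (y x)) (ttail (y x)))).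
    by move=> x; rewrite ttail_cons.
  apply: (recursive_comp rf); apply: recursive_tuple_cons.
    exact: recursive_thead.
  exact: recursive_tuple_comp (@recursive_tuple_ttail _)
                              (@recursive_tuple_ttail _).
move=> /(_ r); apply: eq_recursive => x.
by elim: (t x) => [|n /= ->]; rewrite ?big_ord0 ?big_ord_recr.
Qed.

(** * Coding of finite sequences *)

Lemma isqrt_exists n : exists s, n < s.+1 * s.+1.
Proof. by exists n; rewrite mulSn ltnS leq_addr. Qed.

(** The integer square root, taken as a least witness so that [rec_min] shows it recursive. *)
Definition isqrt n := ex_minn (isqrt_exists n).

(** Minimality gives [q <= s]. If [q < s], then [q.+1 * q.+1 <= s * s], which contradicts the choice
    of [q]. *)
Lemma isqrtE s t : t <= s -> isqrt (s * s + t) = s.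
Proof.
move=> le_ts; rewrite /isqrt; case: ex_minnP => q lt_q /(_ s).
have -> : s * s + t < s.+1 * s.+1.
  by rewrite mulSn mulnS addSn ltnS addnA addnC leq_add2r (leq_trans le_ts) ?leq_addr.
move=> /(_ isT) le_qs; apply/eqP; rewrite eqn_leq le_qs /= leqNgt.
apply/negP => lt_qs; move: lt_q; rewrite ltnNge => /negP; apply.
by apply: leq_trans (leq_addr _ _); apply: leq_mul.
Qed.

Lemma recursive_isqrt : recursive1 isqrt.
Proof.
(* With a candidate [s] in the head and [n] behind it, this truncated difference is zero exactly
   when [n < s.+1 * s.+1]. *)
pose f (x : 2.-tuple nat) :=
  (thead (ttail x)).+1 - (thead x).+1 * (thead x).+1.
have rf : recursive f.
  have r0 := @recursive_thead 1.
  apply: recursive_sub; first exact/recursive_succ/recursive_ttail/recursive_thead.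
  by apply: recursive_mul; apply: recursive_succ.
apply: (rec_min rf) => [x|x y]; rewrite /f ttail_cons /= /isqrt.
  by case: ex_minnP => s lt_s _; apply/eqP; rewrite subn_eq0.
case: ex_minnP => s _ min_s; rewrite ltnNge => /negP le_sy /eqP.
by rewrite subn_eq0 => /min_s.
Qed.

(* [s ^ 2 + x], where [s = x + y], codes the pair [(x, y)]. *)
Definition pair_code x y := (x + y) * (x + y) + x.
Definition code_fst n := n - isqrt n * isqrt n.
Definition code_snd n := isqrt n - code_fst n.

Lemma pair_codeK1 x y : code_fst (pair_code x y) = x.
Proof. by rewrite /code_fst /pair_code isqrtE ?leq_addr // addKn. Qed.

Lemma pair_codeK2 x y : code_snd (pair_code x y) = y.
Proof. by rewrite /code_snd pair_codeK1 /pair_code isqrtE ?leq_addr // addKn. Qed.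

Lemma recursive_code_fst : recursive1 code_fst.
Proof.
have r := recursive_isqrt.
by apply: recursive_sub; [exact: recursive_thead|exact: recursive_mul].
Qed.

Lemma recursive_code_snd : recursive1 code_snd.
Proof. exact: recursive_sub recursive_isqrt recursive_code_fst. Qed.

(** A sequence is coded by nested pairs with no length stored: every number codes an infinite
    sequence, and users read only the initial segment they care about. *)
Definition entry T i := code_fst (iter i code_snd T).

Lemma recursive_entry k (f g : k.-tuple nat -> nat) :
  recursive f -> recursive g -> recursive (fun x => entry (f x) (g x)).
Proof.
move=> rf rg; apply: (recursive_comp1 recursive_code_fst).
have := recursive_nat_rect (s := fun _ y _ => code_snd y) rg rf.
have r : recursive (fun x : k.+2.-tuple nat => code_snd (thead (ttail x))).
  apply: (recursive_comp1 recursive_code_snd).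
  exact/recursive_ttail/recursive_thead.
by move=> /(_ r); apply: eq_recursive => x; elim: (g x) => //= n ->.
Qed.

(** Finite choice, internalized in one number: the induction shifts [P] by one and prepends the
    witness for index 0 as the first component of a pair. *)
Lemma ex_entry (P : nat -> nat -> Prop) n :
  (forall i, i < n -> exists y, P i y) ->
  exists T, forall i, i < n -> P i (entry T i).
Proof.
elim: n P => [|n IHn] P exP; first by exists 0.
have [//|y Py] := exP 0.
have [i /(exP i.+1) //|T TP] := IHn (fun i => P i.+1).
exists (pair_code y T) => -[|i] lt_in; first by rewrite /entry /= pair_codeK1.
by rewrite /entry iterSr pair_codeK2; apply: TP.
Qed.

(** * Projections of recursive sets *)

(** Recursive enumerability as the projection of a recursive zero set, with the witness in the head
    coordinate. Closure properties are proved in this form, and [sigma1P] transfers them to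
    enumerations. *)
Definition sigma1 k (P : set (k.-tuple nat)) : Prop :=
  exists2 f : k.+1.-tuple nat -> nat, recursive f &
    forall x, P x <-> exists m, f [tuple of m :: x] = 0.

Lemma eq_sigma1 k (P Q : set (k.-tuple nat)) :
  (forall x, P x <-> Q x) -> sigma1 P -> sigma1 Q.
Proof. by move=> eqPQ; have -> : P = Q by apply/seteqP; split=> x /eqPQ. Qed.

Lemma sigma1_eq0 k (f : k.-tuple nat -> nat) :
  recursive f -> sigma1 (fun x => f x = 0).
Proof.
move=> /recursive_ttail rf; exists (fun x => f (ttail x)) => //.
move=> x; split; first by exists 0; rewrite ttail_cons.
by move=> [m]; rewrite ttail_cons.
Qed.

Lemma sigma1_eq k (f g : k.-tuple nat -> nat) :
  recursive f -> recursive g -> sigma1 (fun x => f x = g x).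
Proof.
move=> rf rg.
(* The two truncated differences both vanish exactly when the values agree. *)
have := sigma1_eq0 (recursive_add (recursive_sub rf rg) (recursive_sub rg rf)).
apply: eq_sigma1 => x.
split=> [/eqP|->]; last by rewrite subnn.
by rewrite addn_eq0 !subn_eq0 -eqn_leq => /eqP.
Qed.

Lemma sigma1_preimage k m (P : set (m.-tuple nat))
    (g : k.-tuple nat -> m.-tuple nat) :
  sigma1 P -> recursive_tuple g -> sigma1 (fun x => P (g x)).
Proof.
move=> [f rf Pf] rg.
exists (fun x => f [tuple of thead x :: g (ttail x)]).
  apply: recursive_comp rf _; apply: recursive_tuple_cons.
    exact: recursive_thead.
  exact: recursive_tuple_comp rg (@recursive_tuple_ttail k).
move=> x; rewrite Pf.
by split=> -[m' fm']; exists m'; move: fm'; rewrite ttail_cons theadE.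
Qed.

(** The quantified [y] and the witness [m] for [P y x] are merged into a single witness by
    [pair_code]. *)
Lemma sigma1_ex k (P : nat -> set (k.-tuple nat)) :
  sigma1 (fun x : k.+1.-tuple nat => P (thead x) (ttail x)) ->
  sigma1 (fun x => exists y, P y x).
Proof.
move=> [f rf Pf].
pose y (x : k.+1.-tuple nat) := [tuple of code_snd (thead x) ::
  [tuple of code_fst (thead x) :: ttail x]].
exists (fun x => f (y x)).
  apply: (recursive_comp rf); apply: recursive_tuple_cons.
    exact: recursive_comp1 recursive_code_snd (recursive_thead _).
  apply: recursive_tuple_cons (@recursive_tuple_ttail k).
  exact: recursive_comp1 recursive_code_fst (recursive_thead _).
move=> x; split=> [[z Pz]|[m]].
  have := Pf [tuple of z :: x]; rewrite theadE ttail_cons.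
  move=> [/(_ Pz) [m fm] _]; exists (pair_code z m).
  by rewrite /y theadE pair_codeK1 pair_codeK2 ttail_cons.
rewrite /y theadE ttail_cons => fm; exists (code_fst m).
have := Pf [tuple of code_fst m :: x]; rewrite theadE ttail_cons => ->.
by exists (code_snd m).
Qed.

(** A product vanishes when one factor does, so a witness for either side serves unchanged. *)
Lemma sigma1_or k (P Q : set (k.-tuple nat)) :
  sigma1 P -> sigma1 Q -> sigma1 (fun x => P x \/ Q x).
Proof.
move=> [f rf Pf] [g rg Qg]; exists (fun x => f x * g x); first exact: recursive_mul.
move=> x; rewrite Pf Qg; split=> [[] [m m0]|[m /eqP]].
- by exists m; rewrite m0.
- by exists m; rewrite m0 muln0.
- by rewrite muln_eq0 => /orP[] /eqP; [left|right]; exists m.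
Qed.

(* A code of the sequence of witnesses for all [i < t x] serves as one witness. *)
Lemma sigma1_ball k (t : k.-tuple nat -> nat) (P : nat -> set (k.-tuple nat)) :
  recursive t ->
  sigma1 (fun x : k.+1.-tuple nat => P (thead x) (ttail x)) ->
  sigma1 (fun x => forall i, i < t x -> P i x).
Proof.
move=> rt [f rf Pf].
have PfE i x : P i x <-> exists m, f [tuple of m :: [tuple of i :: x]] = 0.
  by have := Pf [tuple of i :: x]; rewrite theadE ttail_cons.
(* A sum of natural numbers is zero exactly when all its terms are, which turns the bounded
   quantifier into one equation. *)
pose g w (x : k.-tuple nat) :=
  \sum_(i < t x) f [tuple of entry w i :: [tuple of (i : nat) :: x]].
exists (fun x => g (thead x) (ttail x)).
  apply: (recursive_sum (k := k.+1) (f := fun i x =>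
    f [tuple of entry (thead x) i :: [tuple of i :: ttail x]])).
    exact: recursive_ttail.
  apply: (recursive_comp rf); apply: recursive_tuple_cons.
    apply: recursive_entry; last exact: recursive_thead.
    exact/recursive_ttail/recursive_thead.
  apply: recursive_tuple_cons; first exact: recursive_thead.
  exact: recursive_tuple_comp (@recursive_tuple_ttail _)
                              (@recursive_tuple_ttail _).
move=> x; split=> [Px|[w]].
  have [i /Px /PfE //|w fw] := @ex_entry
    (fun i m => f [tuple of m :: [tuple of i :: x]] = 0) (t x).
  exists w; rewrite theadE ttail_cons; apply: big1 => i _; exact: fw.
rewrite theadE ttail_cons /g => /eqP; rewrite sum_nat_eq0 => /forallP fw i lt_i.
by apply/PfE; exists (entry w i); have /eqP := fw (Ordinal lt_i).
Qed.

(** The two sides may need different witnesses, hence a pair of them; the sum vanishes when both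
    terms do. *)
Lemma sigma1_and k (P Q : set (k.-tuple nat)) :
  sigma1 P -> sigma1 Q -> sigma1 (fun x => P x /\ Q x).
Proof.
move=> [f rf Pf] [g rg Qg].
exists (fun x => f [tuple of code_fst (thead x) :: ttail x] +
                 g [tuple of code_snd (thead x) :: ttail x]).
  apply: recursive_add.
    apply: (recursive_comp rf); apply: recursive_tuple_cons.
      exact: recursive_comp1 recursive_code_fst (recursive_thead _).
    exact: recursive_tuple_ttail.
  apply: (recursive_comp rg); apply: recursive_tuple_cons.
    exact: recursive_comp1 recursive_code_snd (recursive_thead _).
  exact: recursive_tuple_ttail.
move=> x; rewrite Pf Qg; split=> [[[m fm] [n gn]]|[m]].
  exists (pair_code m n).
  by rewrite theadE ttail_cons pair_codeK1 pair_codeK2 fm gn.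
rewrite theadE ttail_cons => /eqP; rewrite addn_eq0 => /andP[/eqP fm /eqP gm].
by split; [exists (code_fst m)|exists (code_snd m)].
Qed.

Lemma sigma1_all k m (P : 'I_m -> set (k.-tuple nat)) :
  (forall i, sigma1 (P i)) -> sigma1 (fun x => forall i, P i x).
Proof.
elim: m P => [|m IHm] P sP.
  apply: (@eq_sigma1 _ (fun x => 0 = 0)) => [x|]; first by split=> // _ [].
  exact: sigma1_eq0 (recursive_const _ _).
have := sigma1_and (sP ord0) (IHm _ (fun i => sP (lift ord0 i))).
apply: eq_sigma1 => x; split=> [[P0 PS] i|Px]; last by split.
by case: (unliftP ord0 i) => [j|] ->.
Qed.

Lemma sigma1_some k m (P : 'I_m -> set (k.-tuple nat)) :
  (forall i, sigma1 (P i)) -> sigma1 (fun x => exists i, P i x).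
Proof.
elim: m P => [|m IHm] P sP.
  apply: (@eq_sigma1 _ (fun x => 1 = 0)) => [x|]; first by split=> // -[] [].
  exact: sigma1_eq0 (recursive_const _ _).
have := sigma1_or (sP ord0) (IHm _ (fun i => sP (lift ord0 i))).
apply: eq_sigma1 => x; split=> [[P0|[i Pi]]|[i]].
- by exists ord0.
- by exists (lift ord0 i).
- by case: (unliftP ord0 i) => [j|] -> Pi; [right; exists j|left].
Qed.

(** Minimization runs over codes of pairs of a value and a witness for it, and is total by the
    second hypothesis. The function returns the value in the least such pair, which need not be the
    least value. *)
Lemma sigma1_uniformization k (P : nat -> set (k.-tuple nat)) :
  sigma1 (fun x : k.+1.-tuple nat => P (thead x) (ttail x)) ->
  (forall x, exists y, P y x) ->
  exists2 h, recursive h & forall x, P (h x) x.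
Proof.
move=> [f rf Pf] exP.
have PfE y x : P y x <-> exists m, f [tuple of m :: [tuple of y :: x]] = 0.
  by have := Pf [tuple of y :: x]; rewrite theadE ttail_cons.
pose y (x : k.+1.-tuple nat) := [tuple of code_snd (thead x) ::
  [tuple of code_fst (thead x) :: ttail x]].
have exf (x : k.-tuple nat) : exists w, f (y [tuple of w :: x]) == 0.
  have [z /PfE[m fm]] := exP x; exists (pair_code z m).
  by rewrite /y theadE pair_codeK1 pair_codeK2 ttail_cons fm.
have rh : recursive (fun x => ex_minn (exf x)).
  apply: (@rec_min _ (fun x => f (y x))).
  - apply: (recursive_comp rf); apply: recursive_tuple_cons.
      exact: recursive_comp1 recursive_code_snd (recursive_thead _).
    apply: recursive_tuple_cons (@recursive_tuple_ttail k).
    exact: recursive_comp1 recursive_code_fst (recursive_thead _).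
  - by move=> x; case: ex_minnP => w /eqP.
  - move=> x z; case: ex_minnP => w _ min_w; rewrite ltnNge => /negP le_wz /eqP.
    by move/min_w.
exists (fun x => code_fst (ex_minn (exf x))).
  exact: recursive_comp1 recursive_code_fst rh.
move=> x; case: ex_minnP => w /eqP; rewrite /y theadE ttail_cons => fw _.
by apply/PfE; exists (code_snd w).
Qed.

(** A range is the projection of the relation [f m = x]. Conversely, [n] is decoded into a candidate
    witness followed by a candidate point, and the point is output if the witness is correct. *)
Lemma sigma1P k (P : set (k.-tuple nat)) : listable_set P <-> sigma1 P.
Proof.
split=> [[->|[f rf ->]]|[f rf Pf]].
- apply: (@eq_sigma1 _ (fun x => 1 = 0)) => [x|]; first by split.
  exact: sigma1_eq0 (recursive_const _ _).
- apply: (@eq_sigma1 _ (fun x => exists m, forall j, tnth (f m) j = tnth x j)).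
    move=> x; split=> [[m fm]|[m _ <-]]; last by exists m.
    by exists m => //; apply: eq_from_tnth.
  apply: sigma1_ex; apply: sigma1_all => j; apply: sigma1_eq.
    exact: recursive_comp1 (rf j) (recursive_thead _).
  exact: recursive_tuple_ttail.
have [->|/set0P[x0 Px0]] := eqVneq P set0; [by left|right].
pose d n : k.+1.-tuple nat := [tuple entry n i | i < k.+1].
(* The fixed member [x0] of [P] is the output when the test fails, so [e] never leaves [P]. *)
pose e n := if f (d n) == 0 then ttail (d n) else x0.
have rd : @recursive_tuple 1 _ (fun y => d (thead y)).
  apply: recursive_tuple_mktuple => j.
  exact: recursive_entry (recursive_thead _) (recursive_const _ _).
exists e => [j|].
  have := recursive_if (recursive_comp rf rd)
    (recursive_tuple_comp (@recursive_tuple_ttail k) rd j)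
    (recursive_const 1 (tnth x0 j)).
  by apply: eq_recursive => y; rewrite /e; case: ifP.
apply/seteqP; split=> [x|_ [n _ <-]].
  move=> /Pf[m fm]; pose z := [tuple of m :: x].
  have [i _|n nP] := @ex_entry (fun i y => y = nth 0 z i) k.+1.
    by exists (nth 0 z i).
  have dn : d n = z.
    by apply: eq_from_tnth => j; rewrite tnth_mktuple nP // (tnth_nth 0).
  by exists n; rewrite // /e dn fm /= ttail_cons.
rewrite /e; case: eqP => // fd; apply/Pf; exists (thead (d n)).
by rewrite -fd; congr f; apply: val_inj; rewrite [in RHS](tuple_eta (d n)).
Qed.

(** * Listable presentations *)

Lemma map_tuple_rcons A B (f : A -> B) k (x : k.-tuple A) a :
  map_tuple f [tuple of rcons x a] = [tuple of rcons (map_tuple f x) (f a)].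
Proof. by apply: val_inj; rewrite /= map_rcons. Qed.

Lemma rcons_tuple_inj T k (x y : k.-tuple T) a b :
  [tuple of rcons x a] = [tuple of rcons y b] -> x = y /\ a = b.
Proof. by move=> /(congr1 val) /= /rcons_inj[/val_inj -> ->]. Qed.

Lemma total_graph_rcons k M (f : k.-tuple M -> M)
    (x : k.-tuple M) a :
  total_graph f [tuple of rcons x a] <-> f x = a.
Proof.
split=> [[y xa]|<-]; last by exists x.
by have [-> ->] := rcons_tuple_inj xa.
Qed.

Lemma graph_rcons k M (V : set (k.-tuple M)) (F : V -> M)
    (x : k.-tuple M) a :
  graph F [tuple of rcons x a] <-> exists2 v : V, val v = x & F v = a.
Proof.
split=> [[v xa]|[v <- <-]]; exists v => //;
  by have [xv av] := rcons_tuple_inj xa; rewrite ?xv ?av.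
Qed.

(** * Pullbacks of positive existential sets along a listable presentation *)

Section Presentation.
Variables (L : language) (M : Type) (S : structure L M) (rho : nat -> M).
Hypothesis rhoP : listable_presentation S rho.

Lemma presentation_surj u : exists n, rho n = u.
Proof. by case: rhoP => /(_ u I)[n _ <-] _ _ _; exists n. Qed.

Lemma sigma1_presentation_eq k (g h : k.-tuple nat -> nat) :
  recursive g -> recursive h -> sigma1 (fun x => rho (g x) = rho (h x)).
Proof.
move=> rg rh; case: rhoP => _ /sigma1P diag _ _.
have := @sigma1_preimage k _ _
  (fun x => [tuple of g x :: [tuple of h x :: [tuple]]]) diag.
apply; apply: recursive_tuple_cons => //.
by apply: recursive_tuple_cons => // -[].
Qed.

(** The pulled-back graph is recursively enumerable and every value has a name by surjectivity, so
    uniformization finds a name of the value. *)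
Lemma func_realizer (f : func_symb L) :
  exists2 g : (func_arity f).-tuple nat -> nat, recursive g &
    forall x, rho (g x) = func_interp S (map_tuple rho x).
Proof.
case: rhoP => _ _ /(_ f)/sigma1P sf _.
pose P y (x : (func_arity f).-tuple nat) :=
  func_interp S (map_tuple rho x) = rho y.
have sP : sigma1 (fun x => P (thead x) (ttail x)).
  pose w (x : (func_arity f).+1.-tuple nat) :=
    [tuple of rcons (ttail x) (thead x)].
  have : sigma1 (fun x => pullback rho (total_graph (@func_interp L M S f)) (w x)).
    apply: sigma1_preimage sf _; apply: recursive_tuple_rcons.
      exact: recursive_thead.
    exact: recursive_tuple_ttail.
  apply: eq_sigma1 => x; rewrite /pullback /w /= map_tuple_rcons.
  exact: total_graph_rcons.
have [x|g rg gP] := sigma1_uniformization sP; last by exists g => // x; rewrite -gP.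
by have [y rhoy] := presentation_surj (func_interp S (map_tuple rho x)); exists y.
Qed.

Lemma term_realizer n (t : term L n) :
  exists2 g : n.-tuple nat -> nat, recursive g &
    forall x, rho (g x) = eval S (map_tuple rho x) t.
Proof.
elim: t => [i|f u IHu].
  by exists (fun x => tnth x i) => [|x]; [exact: rec_proj|rewrite /= tnth_map].
have [f' rf' f'P] := func_realizer f.
have /choice[g gP] : forall i, exists g : n.-tuple nat -> nat, recursive g /\
    forall x, rho (g x) = eval S (map_tuple rho x) (u i).
  by move=> i; have [g] := IHu i; exists g.
exists (fun x => f' [tuple g i x | i < func_arity f]).
  by apply: rec_comp => // i; case: (gP i).
move=> x; rewrite f'P /=; congr func_interp; apply: eq_from_tnth => i.
by rewrite tnth_map !tnth_mktuple; case: (gP i).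
Qed.

(** Induction on the formula. Terms are replaced by recursive functions on names, and surjectivity
    of [rho] turns a quantifier over [M] into one over names. *)
Lemma sigma1_sat n (phi : pe_formula L n) :
  sigma1 (pullback rho [set x | sat S phi x]).
Proof.
elim: phi => {n} [n t u|n R u|n p IHp q IHq|n p IHp q IHq|n p IHp].
- have [g rg gP] := term_realizer t; have [h rh hP] := term_realizer u.
  by apply: eq_sigma1 (sigma1_presentation_eq rg rh) => x; rewrite gP hP.
- case: rhoP => _ _ _ /(_ R)/sigma1P sR.
  have /choice[g gP] : forall i, exists g : n.-tuple nat -> nat, recursive g /\
      forall x, rho (g x) = eval S (map_tuple rho x) (u i).
    by move=> i; have [g] := term_realizer (u i); exists g.
  have rg : recursive_tuple (fun x => [tuple g i x | i < rel_arity R]).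
    by apply: recursive_tuple_mktuple => i; case: (gP i).
  apply: eq_sigma1 (sigma1_preimage sR rg) => x; rewrite /pullback /=.
  have -> // : map_tuple rho [tuple g i x | i < rel_arity R] =
    [tuple eval S (map_tuple rho x) (u i) | i < rel_arity R].
  apply: eq_from_tnth => i.
  by rewrite tnth_map !tnth_mktuple; case: (gP i).
- exact: sigma1_and.
- exact: sigma1_or.
- pose P y (x : n.-tuple nat) := sat S p (map_tuple rho [tuple of y :: x]).
  have sP : sigma1 (fun x => P (thead x) (ttail x)).
    by apply: eq_sigma1 IHp => x; rewrite /P /pullback /= [x in X in X <-> _]tuple_eta.
  have mapE y (x : n.-tuple nat) :
      map_tuple rho [tuple of y :: x] = [tuple of rho y :: map_tuple rho x].
    exact: val_inj.
  apply: eq_sigma1 (sigma1_ex sP) => x; rewrite /P /pullback /=.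
  split=> [[y]|[a]]; first by rewrite mapE; exists (rho y).
  by have [y <-] := presentation_surj a; rewrite -mapE; exists y.
Qed.

Lemma sigma1_pe_definable n (D : set (n.-tuple M)) :
  pe_definable_set S D -> sigma1 (pullback rho D).
Proof. by move=> [phi ->]; apply: sigma1_sat. Qed.

(** A pullback along [rho \o a] is the preimage, under [a] applied coordinatewise, of the pullback
    along [rho]. *)
Lemma listable_presentation_comp (a : nat -> nat) :
  recursive1 a -> set_surj [set: nat] [set: M] (rho \o a) ->
  listable_presentation S (rho \o a).
Proof.
move=> ra surj; case: rhoP => _ diag fP RP.
have pb k (Q : set (k.-tuple M)) :
    listable_set (pullback rho Q) -> listable_set (pullback (rho \o a) Q).
  move=> /sigma1P sQ; apply/sigma1P.
  have rmap : recursive_tuple (fun x : k.-tuple nat => map_tuple a x).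
    move=> j; apply: eq_recursive (recursive_comp1 ra (rec_proj j)) => x.
    by rewrite tnth_map.
  apply: eq_sigma1 (sigma1_preimage sQ rmap) => x; rewrite /pullback /=.
  by have -> // : map_tuple rho (map_tuple a x) = map_tuple (rho \o a) x;
    apply: val_inj; rewrite /= -map_comp.
by split=> // *; apply: pb.
Qed.

End Presentation.

(** * Consequences of having a universal listing *)

Section UniversalListing.
Variables (L : language) (M : Type) (S : structure L M) (tau : nat -> M).
Hypothesis tauP : universal_listing S tau.

Lemma universal_listing_presentation :
  listable S -> listable_presentation S tau.
Proof.
case: tauP => surj univ [rho rhoP]; have [a ra rhoa] := univ _ rhoP.
by rewrite -rhoa; apply: listable_presentation_comp => //; rewrite rhoa.
Qed.

(* With [rho \o a = tau = gamma \o b], a number [n] is sent to [a m] for any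
   [m] with [gamma (b m) = gamma n]. *)
Lemma universal_listing_unique : uniquely_listable S.
Proof.
move=> rho gamma rhoP gammaP; case: tauP => surj univ.
have [a ra rhoa] := univ _ rhoP; have [b rb gammab] := univ _ gammaP.
pose P m (x : 1.-tuple nat) := gamma (b m) = gamma (thead x).
have sP : sigma1 (fun x => P (thead x) (ttail x)).
  apply: (sigma1_presentation_eq gammaP).
    exact: recursive_comp1 rb (recursive_thead _).
  exact/recursive_ttail/recursive_thead.
have [x|g rg gP] := sigma1_uniformization sP.
  have [m _ taum] := surj (gamma (thead x)) I.
  by exists m; rewrite /P -taum -gammab.
exists (fun n => a (g [tuple n])).
  apply: (recursive_comp1 ra); apply: eq_recursive rg => x.
  by congr g; apply: eq_from_tnth => i; rewrite (ord1 i).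
apply/funext => n /=.
have := gP [tuple n]; rewrite /P => /= <-.
by rewrite -[gamma _]/((gamma \o b) _) gammab -rhoa.
Qed.

End UniversalListing.

(** * Recursively defined surjections as universal listings *)

Theorem theorem3p27 (L : language) (M : Type) (S : structure L M)
    (S_listable : listable S)
    (r k c : nat) (r_gt0 : 0 < r) (k_gt0 : 0 < k)
    (h : nat -> r.-tuple nat) (h_rec : recursive_map h)
    (h_lt : forall (j : 'I_r) (n : nat), c < n -> tnth (h n) j < n)
    (A : 'I_k -> set nat)
    (A_part : partition [set: 'I_k] A [set n | c < n])
    (A_dec : forall i, decidable_set (A i))
    (V : 'I_k -> set (r.-tuple M)) (F : forall i, V i -> M)
    (F_pe : forall i, pe_definable_function S (@F i))
    (tau : nat -> M)
    (tau_surj : set_surj [set: nat] [set: M] tau)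
    (h_dom : forall i n, A i n -> c < n -> pullback tau (V i) (h n))
    (tau_rec : forall i n (Ain : A i n) (cn : c < n),
       tau n = F i (exist _ (map_tuple tau (h n)) (mem_set (h_dom i n Ain cn)))) :
  universal_listing S tau /\
  uniquely_listable S /\ listable_presentation S tau.
Proof.
have tau_univ : universal_listing S tau; last first.
  split=> //; split; first exact: universal_listing_unique tau_univ.
  exact: universal_listing_presentation.
split=> // rho rhoP.
(* [b] comes from classical choice and need not be recursive. Only its values up to [c] enter
   [step], as constants; the others serve to prove that a suitable sequence exists. *)
have /choice[b bP] : forall n, exists m, rho m = tau n.
  by move=> n; apply: presentation_surj rhoP _.
have coverA n : c < n -> exists i, A i n.
  case: A_part => cov _ _ lt_cn; have : [set n | c < n] n by [].
  by rewrite -cov => -[i _ Ain]; exists i.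
have A_gt i n : A i n -> c < n.
  move=> Ain; have : cover [set: 'I_k] A n by exists i.
  by case: A_part => ->.
pose hT (n T : nat) := [tuple entry T (tnth (h n) l) | l < r].
(* Indexing the initial case by ['I_c.+1] makes it a finite disjunction of equations with
   constants. *)
pose step (n T : nat) := (exists j : 'I_c.+1, n = j :> nat /\ entry T n = b j) \/
  (exists i, A i n /\
     pullback rho (graph (@F i)) [tuple of rcons (hT n T) (entry T n)]).
have step_tau n T : (forall i, i < n.+1 -> step i T) -> rho (entry T n) = tau n.
  elim/ltn_ind: n => n IHn stepT.
  case: (stepT n (ltnSn n)) => [[j [-> ->]]|[i [Ain]]]; first exact: bP.
  rewrite /pullback /= map_tuple_rcons graph_rcons => -[v valv <-].
  have lt_cn := A_gt _ _ Ain.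
  (* Both arguments of [F i] lie in the subtype of [V i], so comparing the underlying tuples is
     enough; their coordinates agree by induction since [h] decreases. *)
  rewrite (tau_rec _ _ Ain lt_cn); congr (F i _); apply: val_inj => /=.
  rewrite valv; apply: eq_from_tnth => l; rewrite !tnth_map tnth_ord_tuple.
  apply: IHn => [|m le_m]; first exact: h_lt.
  by apply: stepT; apply: leq_trans le_m _; rewrite ltnW // ltnS h_lt.
have step_ex n : exists T, forall i, i < n.+1 -> step i T.
  (* The sequence [b 0, ..., b n] satisfies every step, because [b] names the values of [tau]. *)
  have [i _|T TP] := @ex_entry (fun i y => y = b i) n.+1; first by exists (b i).
  exists T => i lt_in.
  have [le_ic|lt_ci] := leqP i c.
    by left; exists (Ordinal (le_ic : i < c.+1)); rewrite TP.
  have [j Aji] := coverA _ lt_ci; right; exists j; split=> //.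
  rewrite /pullback /= map_tuple_rcons graph_rcons TP // bP.
  rewrite (tau_rec _ _ Aji lt_ci); eexists; last by [].
  apply: eq_from_tnth => l; rewrite /= !tnth_map tnth_ord_tuple TP ?bP //.
  by apply: ltn_trans lt_in; apply: h_lt.
pose P y (x : 1.-tuple nat) := exists T,
  (forall i, i < (thead x).+1 -> step i T) /\ y = entry T (thead x).
have sP : sigma1 (fun x => P (thead x) (ttail x)).
  have r0 m : recursive (@thead m nat) by exact: recursive_thead.
  have r1 m : recursive (fun x : m.+2.-tuple nat => thead (ttail x)).
    exact/recursive_ttail/r0.
  have r2 : recursive (fun x : 3.-tuple nat => thead (ttail (ttail x))).
    exact/recursive_ttail2/r0.
  (* The variables are now ordered [T, y, n]; the bounded quantifier below adds [i] in front, giving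
     [i, T, y, n]. *)
  apply: sigma1_ex; apply: sigma1_and; last first.
    by apply: sigma1_eq => //; apply: recursive_entry.
  apply: sigma1_ball; first exact: recursive_succ.
  have rentry : recursive (fun x : 4.-tuple nat => entry (thead (ttail x)) (thead x)).
    exact: recursive_entry.
  apply: sigma1_or; apply: sigma1_some => i.
    by apply: sigma1_and; apply: sigma1_eq => //; apply: recursive_const.
  apply: sigma1_and.
    have [chi [rchi chiP]] := A_dec i.
    have := sigma1_eq (recursive_comp1 rchi (r0 3)) (recursive_const _ 1).
    by apply: eq_sigma1 => x; rewrite chiP; case: (chi _).
  apply: sigma1_preimage (sigma1_pe_definable rhoP (F_pe i)) _.
  apply: recursive_tuple_rcons => //; apply: recursive_tuple_mktuple => l.
  by apply: recursive_entry => //; apply: recursive_comp1 (h_rec l) (r0 3).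
have [x|g rg gP] := sigma1_uniformization sP.
  by have [T TP] := step_ex (thead x); exists (entry T (thead x)), T.
exists (fun n => g [tuple n]).
  apply: eq_recursive rg => x.
  by congr g; apply: eq_from_tnth => i; rewrite (ord1 i).
(* The value found is [entry T n] for a [T] satisfying all steps up to [n], hence a name of
   [tau n]. *)
by apply/funext => n /=; have [T [/step_tau <- ->]] := gP [tuple n].
Qed.
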